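(* Let $P$ be the probability measure on $\{1,2,3,4,5,6\}\subset\mathbb{R}$ with probability mass function $f(j)=\left(\frac{3}{10}\right)^{j-1}\frac{7}{10}$ for $j\in\{1,2,3,4,5\}$ and $f(6)=\left(\frac{3}{10}\right)^{5}$. The optimal set of five-means for $P$ is $\{1,2,3,4,a[5,6]\}$, with quantization error $V_5(P)=\frac{1701}{1000000}$.
   Context: For a Borel probability measure $P$ on $\mathbb{R}$ and a nonempty finite set $\alpha\subset\mathbb{R}$, the distortion error is $V(P;\alpha)=\int\min_{a\in\alpha}|x-a|^2\,dP(x)$. The $n$th quantization error is $V_n(P)=\inf\{V(P;\alpha):\alpha\subset\mathbb{R},\ 1\le\mathrm{card}(\alpha)\le n\}$, and a set $\alpha$ with $1\le\mathrm{card}(\alpha)\le n$ attaining this infimum is called an optimal set of $n$-means for $P$. For $i\le j$ in $\{1,\dots,6\}$, $a[i,j]=\dfrac{\sum_{k=i}^{j}k f(k)}{\sum_{k=i}^{j}f(k)}$. *)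

(* Defs.v *)
From HB Require Import structures.
From mathcomp Require Import all_boot all_order all_algebra.
From mathcomp Require Import finmap.
From mathcomp Require Import all_classical all_reals all_analysis.
From mathcomp Require Import ring lra.

Set Implicit Arguments.
Unset Strict Implicit.
Unset Printing Implicit Defensive.

Import Order.TTheory GRing.Theory Num.Theory.

Local Open Scope classical_set_scope.
Local Open Scope ring_scope.

(* The minimum is taken in \bar R, where +oo is neutral for [mine]; for a
   nonempty [alpha] it is the real minimum. The empty set, whose distortion
   would be +oo, is excluded in [codebook]. *)
Definition distortion {R : realType} (P : probability (measurableTypeR R) R)
    (alpha : {fset R}) : \bar R :=
  (\int[P]_x \big[mine/+oo]_(a <- alpha) (`|(x : R) - a| ^+ 2)%:E)%E.

Definition codebook {R : realType} (n : nat) : set {fset R} :=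
  [set alpha : {fset R} | (1 <= #|` alpha| <= n)%N].

Definition quantization_error {R : realType}
    (P : probability (measurableTypeR R) R) (n : nat) : \bar R :=
  ereal_inf [set distortion P alpha | alpha in @codebook R n].

Definition optimal_n_means {R : realType}
    (P : probability (measurableTypeR R) R) (n : nat) (alpha : {fset R}) :=
  codebook n alpha /\ distortion P alpha = quantization_error P n.

Definition trunc_geom_pmf (R : realType) (j : nat) : R :=
  if (1 <= j <= 5)%N then (3 / 10) ^+ (j - 1) * (7 / 10)
  else if j == 6%N then (3 / 10) ^+ 5
  else 0.

Lemma trunc_geom_pmf_ge0 (R : realType) (j : nat) : 0 <= trunc_geom_pmf R j.
Proof.
rewrite /trunc_geom_pmf; case: ifP => _; last first.
  by case: ifP => // _; rewrite exprn_ge0//; lra.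
by rewrite mulr_ge0 ?exprn_ge0//; lra.
Qed.

Definition discreteP (R : realType) : set (measurableTypeR R) -> \bar R :=
  msum (fun i => mscale (NngNum (trunc_geom_pmf_ge0 R i.+1))
                        (dirac (i.+1%:R : measurableTypeR R))) 6.

Arguments discreteP : clear implicits.

HB.instance Definition _ (R : realType) := Measure.on (discreteP R).

Lemma discreteP_setT (R : realType) : discreteP R setT = 1%E.
Proof.
rewrite /discreteP /msum !big_ord_recl big_ord0 /= /mscale /= /dirac.
rewrite !indicE !in_setT !mule1 adde0 -!EFinD.
by congr EFin; rewrite /trunc_geom_pmf /=; field.
Qed.

HB.instance Definition _ (R : realType) :=
  @Measure_isProbability.Build _ _ R (discreteP R) (discreteP_setT R).

Lemma discreteP_set1 (R : realType) (j : nat) :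
  (1 <= j <= 6)%N -> discreteP R [set j%:R] = (trunc_geom_pmf R j)%:E.
Proof.
case/andP; case: j => // j _ j6.
rewrite /discreteP /msum (bigD1 (Ordinal j6)) //= /mscale /= /dirac.
rewrite indicE mem_set // mule1 big1 ?adde0 // => i ij.
rewrite indicE memNset ?mule0 //= => /eqP; rewrite eqr_nat eqSS => /eqP e.
by move/eqP: ij; apply; apply: val_inj.
Qed.

Definition cond_mean (R : realType) (i j : nat) : R :=
  (\sum_(i <= k < j.+1) k%:R * trunc_geom_pmf R k) / (\sum_(i <= k < j.+1) trunc_geom_pmf R k).

(* Main.v *)
(* Six atoms are served by at most five points, so two atoms i < j share a
   nearest point a. With p = f(i) and q = f(j), the cost of this pair is
   p (i - a)^2 + q (j - a)^2 >= p q / (p + q) (j - i)^2, with equality only at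
   the weighted mean of i and j. As f decreases, the cheapest pair is
   (5, 6), of cost exactly 1701 / 10^6; meeting this bound forces a = a[5,6] and
   the remaining atoms 1, 2, 3, 4 to be points of the codebook. *)
Require Import Defs.
From mathcomp Require Import all_boot all_order all_algebra.
From mathcomp Require Import finmap.
From mathcomp Require Import all_classical all_reals all_analysis.
From mathcomp Require Import measurable_realfun ring lra.

Set Implicit Arguments.
Unset Strict Implicit.
Unset Printing Implicit Defensive.

Import Order.TTheory GRing.Theory Num.Theory.

Local Open Scope ring_scope.

Lemma bigmine_attained (R : realType) (T : eqType) (F : T -> R) (s : seq T) :
  s != [::] ->
  exists2 a, a \in s &
    (forall b, b \in s -> F a <= F b) /\
    \big[mine/+oo%E]_(b <- s) (F b)%:E = (F a)%:E.
Proof.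
elim: s => // x s IH _; case: (eqVneq s [::]) => [->|/IH[a a_s [a_min a_eq]]].
  exists x; first by rewrite mem_head.
  by split => [b|]; [rewrite inE => /eqP-> | rewrite big_cons big_nil miney].
rewrite big_cons a_eq; have [le_xa|lt_ax] := leP (F x) (F a).
- exists x; first by rewrite mem_head.
  split; last by apply/min_idPl; rewrite lee_fin.
  by move=> b; rewrite inE => /predU1P[->//|/a_min]; exact: le_trans.
- exists a; first by rewrite inE a_s orbT.
  split; last by apply/min_idPr; rewrite lee_fin ltW.
  by move=> b; rewrite inE => /predU1P[->|/a_min//]; exact: ltW.
Qed.

Lemma measurable_bigmine d (T : measurableType d) (R : realType) (I : Type)
    (D : set T) (h : I -> T -> \bar R) (s : seq I) :
  (forall i, measurable_fun D (h i)) ->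
  measurable_fun D (fun x => \big[mine/+oo%E]_(i <- s) h i x).
Proof.
move=> mh; elim: s => [|i s IH].
  by under eq_fun do rewrite big_nil; exact: measurable_cst.
by under eq_fun do rewrite big_cons; exact: measurable_mine.
Qed.

Lemma integral_discreteP (R : realType) (g : measurableTypeR R -> \bar R) :
  measurable_fun setT g -> (forall x, 0 <= g x)%E ->
  (\int[discreteP R]_x g x =
   \sum_(k < 6) (trunc_geom_pmf R k.+1)%:E * g k.+1%:R)%E.
Proof.
move=> mg g0; rewrite /discreteP ge0_integral_measure_sum//.
apply: eq_bigr => k _.
by rewrite ge0_integral_mscale// integral_dirac// diracT mul1e.
Qed.

(** [c k] is the point serving atom [k]. Forgetting the codebook leaves a polynomial in the six
    reals [c 1], ..., [c 6]. *)
Definition assignment_cost (R : realType) (c : nat -> R) : R :=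
  \sum_(k < 6) trunc_geom_pmf R k.+1 * (k.+1%:R - c k.+1) ^+ 2.

(** A minimum over a nonempty finite set is attained, so each atom can choose a nearest point.
    Membership of [c j] feeds the lower bound, minimality the upper one. *)
Lemma distortion_nearest (R : realType) (alpha : {fset R}) :
  (0 < #|` alpha|)%N ->
  exists c : nat -> R,
    [/\ forall j, c j \in alpha,
        forall j a, a \in alpha -> (j%:R - c j) ^+ 2 <= (j%:R - a) ^+ 2 &
        distortion (discreteP R) alpha = (assignment_cost c)%:E].
Proof.
move=> alpha_gt0.
have alphaN0 : (alpha : seq R) != [::] by rewrite -size_eq0 -lt0n.
have nearest (j : nat) : exists a, [/\ a \in alpha,
    forall b, b \in alpha -> (j%:R - a) ^+ 2 <= (j%:R - b) ^+ 2 &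
    \big[mine/+oo%E]_(b <- alpha) (`|j%:R - b| ^+ 2)%:E =
      ((j%:R - a) ^+ 2)%:E].
  have [a a_in [a_min a_eq]] :=
    bigmine_attained (fun b : R => (j%:R - b) ^+ 2) alphaN0.
  exists a; split=> //; rewrite -a_eq.
  by apply: eq_bigr => b _; rewrite real_normK// num_real.
have [c cP] := choice nearest.
exists c; split=> [j|j|]; [by case: (cP j) | by case: (cP j) | ].
rewrite /distortion integral_discreteP.
- rewrite /assignment_cost -sumEFin; apply: eq_bigr => k _.
  by have [_ _ ->] := cP k.+1; rewrite EFinM.
- apply: measurable_bigmine => a; apply/measurable_EFinP.
  apply: measurable_funX; apply: measurableT_comp => //.
  exact: measurable_funB.
- move=> x; apply: (big_ind (fun y => 0 <= y)%E) => [|y z y0 z0|a _].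
  + exact: leey.
  + by rewrite le_min y0.
  + by rewrite lee_fin sqr_ge0.
Qed.

Lemma cond_mean56 (R : realType) : cond_mean R 5 6 = 53 / 10.
Proof.
rewrite /cond_mean /index_iota /= !big_cons !big_nil /trunc_geom_pmf/=.
by field.
Qed.

Lemma assignment_costE (R : realType) (c : nat -> R) : assignment_cost c =
  7 / 10 * (1 - c 1) ^+ 2 + 21 / 100 * (2 - c 2) ^+ 2 +
  63 / 10 ^+ 3 * (3 - c 3) ^+ 2 + 189 / 10 ^+ 4 * (4 - c 4) ^+ 2 +
  567 / 10 ^+ 5 * (5 - c 5) ^+ 2 + 243 / 10 ^+ 5 * (6 - c 6) ^+ 2.
Proof.
rewrite /assignment_cost !big_ord_recl big_ord0 /= /trunc_geom_pmf /bump /=.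
by field.
Qed.

(** Variance decomposition of two weighted points about [a], multiplied by [p + q] to avoid
    division. The last square measures how far [a] is from the weighted mean. *)
Lemma merge_cost (R : comNzRingType) (p q x y a : R) :
  (p + q) * (p * (x - a) ^+ 2 + q * (y - a) ^+ 2) =
  p * q * (y - x) ^+ 2 + (p * x + q * y - (p + q) * a) ^+ 2.
Proof. by ring. Qed.

(** Assuming the cost is at most the bound yields the lower bound and its equality case together. *)
Lemma assignment_cost_merge (R : realType) (c : nat -> R) (i j : nat) :
  (1 <= i < j)%N -> (j <= 6)%N -> c i = c j ->
  assignment_cost c <= 1701 / 10 ^+ 6 ->
  assignment_cost c = 1701 / 10 ^+ 6 /\
  [/\ c 1 = 1, c 2 = 2, c 3 = 3, c 4 = 4 & c 5 = 53 / 10].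
Proof.
move=> /andP[i_gt0 ltij] le_j6 eq_c; rewrite assignment_costE.
have sq_ge0 k : 0 <= (k%:R - c k) ^+ 2 by exact: sqr_ge0.
have := (sq_ge0 1, sq_ge0 2, sq_ge0 3, sq_ge0 4, sq_ge0 5, sq_ge0 6)%N.
rewrite mulr1n => -[] [] [] [] [] s1 s2 s3 s4 s5 s6.
have [i_le4|i_gt4] := leqP i 4.
  (* The weights decrease, so [i <= 4] and [j <= 6] bound them below by those
     of [4] and [6], which already cost more than merging [5] with [6]. *)
  have cost_ij : 1701 / 10 ^+ 6 < 189 / 10 ^+ 4 * (i%:R - c i) ^+ 2
                                  + 243 / 10 ^+ 5 * (j%:R - c j) ^+ 2.
    have dist_ge1 : 1 <= (j%:R - i%:R : R) ^+ 2.
      by rewrite -natrB ?(ltnW ltij)// expr_ge1// ler1n subn_gt0.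
    have := merge_cost (189 / 10 ^+ 4) (243 / 10 ^+ 5) i%:R j%:R (c j).
    have := sqr_ge0 (189 / 10 ^+ 4 * i%:R + 243 / 10 ^+ 5 * j%:R
                     - (189 / 10 ^+ 4 + 243 / 10 ^+ 5) * c j).
    rewrite -eq_c; move: dist_ge1.
    (* With the four squares as atoms, the claim is linear. *)
    move: (_ ^+ 2) (_ ^+ 2) (_ ^+ 2) (_ ^+ 2) => A B C D; lra.
  move=> cost_le; exfalso; clear eq_c sq_ge0.
  case: i i_gt0 i_le4 ltij cost_ij => [|[|[|[|[|//]]]]] // _ _;
  by case: j le_j6 => [|[|[|[|[|[|[|//]]]]]]] // _ _ cost_ij; lra.
have ei : i = 5 by apply/eqP; rewrite eqn_leq i_gt4 andbT -ltnS (leq_trans ltij).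
have ej : j = 6 by apply/eqP; rewrite eqn_leq le_j6 (leq_ltn_trans i_gt4).
rewrite {}ei {}ej in eq_c; rewrite -eq_c in s6 *.
(* [53 / 10] is the weighted mean of 5 and 6. By [merge_cost] the cost is the bound plus positive
   multiples of this square and of those for atoms 1 to 4, so all five vanish. *)
have := sqr_ge0 (53 / 10 - c 5).
have := merge_cost (567 / 10 ^+ 5) (243 / 10 ^+ 5) 5 6 (c 5).
have sq0 (x y : R) : (x - y) ^+ 2 = 0 -> y = x.
  by move/eqP; rewrite sqrf_eq0 subr_eq0 => /eqP.
move=> mc s cost_le; split; first by lra.
by split; apply: sq0; lra.
Qed.

(** Pigeonhole: six distinct values would not fit in [alpha]. List positions start at 0 and atoms at
    1, hence the shift in the witnesses. *)
Lemma collision (R : realType) (alpha : {fset R}) (c : nat -> R) :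
  (#|` alpha| <= 5)%N -> (forall j, c j \in alpha) ->
  exists i j, [/\ (1 <= i < j)%N, (j <= 6)%N & c i = c j].
Proof.
move=> card_alpha c_alpha.
have /(uniqPn 0)[i [j [ltij]]] : ~~ uniq [seq c j | j <- iota 1 6].
  apply/negP => /uniq_leq_size -/(_ alpha); rewrite leqNgt ltnS card_alpha.
  by move=> /(_ _)/notF; apply=> _ /mapP[j _ ->].
rewrite size_map size_iota => j_lt6; have i_lt6 := ltn_trans ltij j_lt6.
rewrite !(nth_map 0%N) ?size_iota// !nth_iota// !add1n => eq_c.
by exists i.+1, j.+1.
Qed.

Lemma card_five_means (R : realType) :
  #|` [fset 1; 2; 3; 4; 53 / 10 : R]%fset| = 5%N.
Proof.
have add1 (x : R) (B : {fset R}) :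
    x \notin B -> #|` (B `|` [fset x])%fset| = #|` B|.+1.
  by move=> xB; rewrite fsetUC cardfsU1 xB.
rewrite !add1 ?cardfs1// !inE ?negb_or -?andbA.
all: rewrite -?andbA; do ?[apply/andP; split]; apply/eqP => ?; lra.
Qed.

(** Each nearest point is compared with a guess: atoms 1 to 4 serve themselves, 5 and 6 go to
    [53 / 10]. Equality comes later, from the lower bound. *)
Lemma distortion_five_means (R : realType) :
  (distortion (discreteP R) ([fset 1; 2; 3; 4; 53 / 10]%fset)%R
   <= (1701 / 10 ^+ 6)%:E)%E.
Proof.
set A := [fset _; _; _; _; _]%fset.
have [|c [_ c_min ->]] := @distortion_nearest R A.
  by rewrite cardfs_gt0; apply/fset0Pn; exists 1; rewrite !inE eqxx.
rewrite lee_fin assignment_costE.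
have inA (x : R) : x \in [:: 1; 2; 3; 4; 53 / 10] -> x \in A.
  by rewrite !inE -!orbA.
have c1 := c_min 1%N 1 (inA 1 _).
have c2 := c_min 2%N 2 (inA 2 _).
have c3 := c_min 3%N 3 (inA 3 _).
have c4 := c_min 4%N 4 (inA 4 _).
have c5 := c_min 5%N (53 / 10) (inA _ _).
have c6 := c_min 6%N (53 / 10) (inA _ _).
move: c1 c2 c3 c4 c5 c6; rewrite !inE !eqxx ?orbT mulr1n.
move=> /(_ isT) c1 /(_ isT) c2 /(_ isT) c3 /(_ isT) c4 /(_ isT) c5 /(_ isT) c6.
lra.
Qed.

Theorem proposition3p10 (R : realType) :
  (forall alpha : {fset R},
     optimal_n_means (discreteP R) 5 alpha <->
     alpha = [fset 1; 2; 3; 4; cond_mean R 5 6]%fset) /\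
  quantization_error (discreteP R) 5 = (1701 / 10 ^+ 6)%:E.
Proof.
rewrite cond_mean56; set A := [fset _; _; _; _; _]%fset.
have cbA : codebook 5 A by rewrite /codebook/= card_five_means.
have lower alpha : codebook 5 alpha ->
    (distortion (discreteP R) alpha <= (1701 / 10 ^+ 6)%:E)%E ->
    distortion (discreteP R) alpha = (1701 / 10 ^+ 6)%:E /\ alpha = A.
  move=> /andP[alpha_gt0 alpha_le5].
  have [c [c_alpha _ ->]] := distortion_nearest alpha_gt0.
  have [i [j [ij j_le6 eq_c]]] := collision alpha_le5 c_alpha.
  rewrite lee_fin => /(assignment_cost_merge ij j_le6 eq_c)[-> cE].
  (* The equality case puts all five points of [A] in [alpha], which has at most five. *)
  split=> //; apply/esym/eqP; rewrite eqEfcard card_five_means alpha_le5 andbT.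
  case: cE => c1 c2 c3 c4 c5.
  rewrite !fsubUset !fsub1set.
  by rewrite -{1}c1 -{1}c2 -{1}c3 -{1}c4 -{1}c5 !c_alpha.
have costA : distortion (discreteP R) A = (1701 / 10 ^+ 6)%:E.
  by have [] := lower _ cbA (distortion_five_means R).
have errE : quantization_error (discreteP R) 5 = (1701 / 10 ^+ 6)%:E.
  apply/eqP; rewrite eq_le; apply/andP; split.
    by apply: ereal_inf_lbound; exists A.
  apply: le_ereal_inf_tmp => _ [alpha cb <-].
  (* A distortion strictly below the bound would equal it by [lower]. *)
  rewrite leNgt; apply/negP => lt_v.
  by have [eq_v _] := lower _ cb (ltW lt_v); rewrite eq_v ltxx in lt_v.
split=> // alpha; rewrite /optimal_n_means errE; split=> [[cb eq_v]|->//].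
by have [] := lower _ cb; rewrite ?eq_v.
Qed.
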